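(* Let $n>1$. For every sequence $(x_j)_{j\ge 1}$ with values in $\{a_1,a_2,\dots,a_n\}\subseteq K_n$, with partial products $s_0=e$ and $s_j=x_1x_2\cdots x_j$ for $j\ge 1$, there exists $m_0\in\mathbb{N}$ such that $s_m=s_{m_0}$ for all $m\ge m_0$.
   Context: Kiselman's semigroup $K_n$ is the monoid, with unit element $e$, given by generators $a_1,\dots,a_n$ and relations $a_i^2=a_i$ for all $1\le i\le n$, and $a_i a_j a_i = a_j a_i a_j = a_i a_j$ for all $1\le j<i\le n$. *)

(* Defs.v *)
From HB Require Import structures.
From mathcomp Require Import all_boot generic_quotient boolp.

Set Implicit Arguments.
Unset Strict Implicit.
Unset Printing Implicit Defensive.

Import Algebra.
Local Open Scope group_scope.
Local Open Scope quotient_scope.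

(* The generator a_k, 1 <= k <= n, is the letter k - 1 : 'I_n; the words over
   these letters form the free monoid. *)

Section Kiselman.
Variable n : nat.
Implicit Types u v w : seq 'I_n.

Inductive kiselman_relation : seq 'I_n -> seq 'I_n -> Prop :=
| KisIdem (i : 'I_n) : kiselman_relation [:: i; i] [:: i]
| KisIJI (i j : 'I_n) : (j < i)%N -> kiselman_relation [:: i; j; i] [:: i; j]
| KisJIJ (i j : 'I_n) : (j < i)%N -> kiselman_relation [:: j; i; j] [:: i; j].

(* The least monoid congruence containing the defining relations. *)
Inductive kiselman_congr : seq 'I_n -> seq 'I_n -> Prop :=
| KisRel u v : kiselman_relation u v -> kiselman_congr u v
| KisRefl u : kiselman_congr u u
| KisSym u v : kiselman_congr u v -> kiselman_congr v u
| KisTrans u v w :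
    kiselman_congr u v -> kiselman_congr v w -> kiselman_congr u w
| KisCat u v u' v' :
    kiselman_congr u v -> kiselman_congr u' v' ->
    kiselman_congr (u ++ u') (v ++ v').

Definition kiselman_eq : rel (seq 'I_n) := fun u v => `[< kiselman_congr u v >].

Lemma kiselman_eq_refl : reflexive kiselman_eq.
Proof. by move=> u; apply/asboolP; exact: KisRefl. Qed.

Lemma kiselman_eq_sym : symmetric kiselman_eq.
Proof. by move=> u v; apply/asboolP/asboolP; exact: KisSym. Qed.

Lemma kiselman_eq_trans : transitive kiselman_eq.
Proof.
by move=> v u w /asboolP uv /asboolP vw; apply/asboolP; exact: KisTrans uv vw.
Qed.

Canonical kiselman_equiv :=
  EquivRel kiselman_eq kiselman_eq_refl kiselman_eq_sym kiselman_eq_trans.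

Definition kiselman := {eq_quot kiselman_equiv}.

HB.instance Definition _ := Choice.on kiselman.
HB.instance Definition _ := EqQuotient.on kiselman.

Lemma kiselmanP u v :
  \pi_kiselman u = \pi_kiselman v <-> kiselman_congr u v.
Proof.
split=> [/eqmodP/asboolP // | uv].
by apply/eqmodP; apply/asboolP.
Qed.

Definition kiselman_one : kiselman := \pi_kiselman [::].
Definition kiselman_mul (x y : kiselman) : kiselman :=
  \pi_kiselman (repr x ++ repr y).

Lemma kiselman_mul_pi u v :
  kiselman_mul (\pi_kiselman u) (\pi_kiselman v) = \pi_kiselman (u ++ v).
Proof. by apply/kiselmanP/KisCat; apply/kiselmanP; rewrite reprK. Qed.

Lemma kiselman_mulA : associative kiselman_mul.
Proof.
elim/quotW=> u; elim/quotW=> v; elim/quotW=> w.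
by rewrite (kiselman_mul_pi v w) (kiselman_mul_pi u v) 2!kiselman_mul_pi catA.
Qed.

Lemma kiselman_mul1 : left_id kiselman_one kiselman_mul.
Proof. by elim/quotW=> u; rewrite kiselman_mul_pi. Qed.

Lemma kiselman_mulr1 : right_id kiselman_one kiselman_mul.
Proof. by elim/quotW=> u; rewrite kiselman_mul_pi cats0. Qed.

HB.instance Definition _ :=
  isMonoid.Build kiselman kiselman_mulA kiselman_mul1 kiselman_mulr1.

Lemma kiselman_mulg_pi u v :
  \pi_kiselman u * \pi_kiselman v = \pi_kiselman (u ++ v).
Proof. exact: kiselman_mul_pi. Qed.

Definition kgen (i : 'I_n) : kiselman := \pi_kiselman [:: i].

Lemma kgen_idem i : kgen i * kgen i = kgen i.
Proof. by rewrite kiselman_mulg_pi; apply/kiselmanP/KisRel/KisIdem. Qed.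

Lemma kgen_iji (i j : 'I_n) :
  (j < i)%N -> kgen i * kgen j * kgen i = kgen i * kgen j.
Proof.
by move=> ji; rewrite (kiselman_mulg_pi [:: i] [:: j]) kiselman_mulg_pi;
  apply/kiselmanP/KisRel/KisIJI.
Qed.

Lemma kgen_jij (i j : 'I_n) :
  (j < i)%N -> kgen j * kgen i * kgen j = kgen i * kgen j.
Proof.
by move=> ji; rewrite (kiselman_mulg_pi [:: j] [:: i]) (kiselman_mulg_pi [:: i] [:: j]);
  rewrite kiselman_mulg_pi; apply/kiselmanP/KisRel/KisJIJ.
Qed.

(* The partial product s_m = x_1 x_2 ... x_m, with s_0 = 1; the value of x at
   index 0 is not used. *)
Definition partial_prod (x : nat -> kiselman) (m : nat) : kiselman :=
  \prod_(1 <= j < m.+1) x j.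

End Kiselman.

(* Main.v *)
(** Once a partial product absorbs [a_k] on the right, it goes on absorbing it
    as long as only smaller letters are appended. Hence, starting with the
    largest letter, from some index on each letter either no longer occurs or is
    absorbed whenever it occurs. *)

Require Import Defs.
From mathcomp Require Import all_boot boolp.

Import Algebra.
Local Open Scope group_scope.

Lemma partial_prodS (n : nat) (x : nat -> kiselman n) (m : nat) :
  partial_prod x m.+1 = partial_prod x m * x m.+1.
Proof. by rewrite /partial_prod big_nat_recr. Qed.

(** As [s] absorbs [a_i], a factor [a_i] can be inserted before [a_j], and then
    [a_i a_j a_i = a_i a_j] applies. *)
Lemma absorb_mul_kgen (n : nat) (s : kiselman n) (i j : 'I_n) :
  (j < i)%N -> s * kgen i = s -> s * kgen j * kgen i = s * kgen j.
Proof.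
by move=> ji si; rewrite -{1}si -!mulgA (mulgA (kgen i)) kgen_iji // mulgA si.
Qed.

(** Induction on [d], the number of largest letters treated so far. Absorption is claimed only where
    the letter occurs, so a letter that dies out satisfies it vacuously. *)
Lemma eventually_absorb (n : nat) (x : nat -> kiselman n)
    (x_gen : forall m : nat, exists i : 'I_n, x m.+1 = kgen i) (d : nat) :
  exists t : nat, forall (i : 'I_n) (m : nat), (n <= i + d)%N -> (t <= m)%N ->
    x m.+1 = kgen i -> partial_prod x m * kgen i = partial_prod x m.
Proof.
elim: d => [|d [t absorb]].
  by exists 0 => i m; rewrite addn0 leqNgt ltn_ord.
have [n_le_d|d_lt_n] := leqP n d.
  by exists t => i m _; apply: absorb; rewrite (leq_trans n_le_d) ?leq_addl.
have k_lt_n : (n - d.+1 < n)%N by rewrite ltn_subrL /= (leq_ltn_trans _ d_lt_n).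
(* The one letter added in passing from [d] to [d.+1]; the letters above it are covered by
   [absorb]. *)
pose k := Ordinal k_lt_n.
have above (i : 'I_n) : (k < i)%N = (n <= i + d)%N.
  by rewrite /= subnSK // leq_subLR addnC.
have at_k (i : 'I_n) : n = (i + d).+1 -> i = k.
  by move=> ni; apply: val_inj; rewrite /= {2}ni subSS addnK.
have [[p tp xp]|no_k] := pselect (exists2 p, (t <= p)%N & x p.+1 = kgen k).
  have absorb_k m : (p < m)%N ->
      partial_prod x m * kgen k = partial_prod x m.
    elim: m => // m IHm; rewrite ltnS leq_eqVlt => /predU1P[<-|pm].
      by rewrite partial_prodS xp -mulgA kgen_idem.
    have [j xj] := x_gen m; rewrite partial_prodS xj.
    (* A smaller letter preserves the absorption of [a_k]; a larger one is itself absorbed, so the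
       product does not change. *)
    have [jk|kj|/val_inj ->] := ltngtP j k.
    - exact/absorb_mul_kgen/IHm.
    - rewrite above in kj.
      by rewrite (absorb j m kj (leq_trans tp (ltnW pm)) xj) (IHm pm).
    - by rewrite !(IHm pm).
  exists p.+1 => i m; rewrite addnS leq_eqVlt ltnS => /predU1P[ni|ki] pm.
    by rewrite (at_k i ni) absorb_k.
  exact: absorb ki (leq_trans tp (ltnW pm)).
exists t => i m; rewrite addnS leq_eqVlt ltnS => /predU1P[ni|ki] tm xi.
  by case: no_k; exists m => //; rewrite xi (at_k i ni).
exact: absorb.
Qed.

Theorem proposition6p1 (n : nat) (n_gt1 : 1 < n) (x : nat -> kiselman n)
    (x_gen : forall j : nat, 1 <= j -> exists i : 'I_n, x j = kgen i) :
  exists m0 : nat, forall m : nat, m0 <= m ->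
    partial_prod x m = partial_prod x m0.
Proof.
(* For [d = n] every letter is covered, so from [t] on no factor changes the product. *)
have [t absorb] := @eventually_absorb n x (fun m => x_gen m.+1 isT) n.
exists t; elim=> [|m IHm]; first by rewrite leqn0 => /eqP->.
rewrite leq_eqVlt => /predU1P[-> //|]; rewrite ltnS => tm.
have [i xi] := x_gen m.+1 isT.
by rewrite partial_prodS xi absorb ?leq_addl ?IHm.
Qed.
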